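(* Let $D$ be a digraph with $\overleftrightarrow{\omega}(D)>\frac23(\Delta_{\max}(D)+1)$. Then $D$ has an acyclic set of vertices $I$ such that $\overleftrightarrow{\omega}(D-I)=\overleftrightarrow{\omega}(D)-1$.
   Context: Digraphs are finite, without loops and without parallel arcs (two opposite arcs $uv$ and $vu$ are allowed and form a digon). For a vertex $v$, $d^+(v)$ and $d^-(v)$ are its out-degree and in-degree, and $\Delta_{\max}(D)=\max_{v\in V(D)}\max(d^+(v),d^-(v))$. A biclique of $D$ is a set of vertices that are pairwise linked by two arcs in opposite directions; $\overleftrightarrow{\omega}(D)$ is the maximum size of a biclique of $D$ (equal to $0$ for the digraph with no vertices). A set of vertices is acyclic if it induces a subdigraph without directed cycles (a digon is a directed cycle of length 2). $D-I$ is the digraph obtained from $D$ by deleting the vertices in $I$. *)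

(* Defs.v *)
From mathcomp Require Import all_boot all_order all_algebra.

Set Implicit Arguments.
Unset Strict Implicit.
Unset Printing Implicit Defensive.

(* The boolean relation [arc] excludes parallel arcs; a digon is a pair u, v
   with both [arc u v] and [arc v u]. The vertex type may be empty. *)
Record digraph := Digraph {
  vertex :> finType;
  arc : rel vertex;
  arc_irrefl : irreflexive arc
}.
Arguments arc {d} _ _.

Section Digraph.
Variable D : digraph.

Definition outdeg (v : D) : nat := #|[set w : D | arc v w]|.
Definition indeg (v : D) : nat := #|[set w : D | arc w v]|.

Definition Delta_max : nat := \max_(v : D) maxn (outdeg v) (indeg v).

Definition biclique (B : {set D}) : bool :=
  [forall x in B, forall y in B, (x != y) ==> (arc x y && arc y x)].

Definition biclique_number : nat := \max_(B : {set D} | biclique B) #|B|.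

(* [ucycle arc c]: the vertices of c are distinct, and consecutive ones
   (cyclically) are joined by an arc. As there are no loops, a nonempty such c
   has length at least 2. *)
Definition acyclic : Prop := forall c : seq D, ucycle arc c -> c = [::].

Lemma induced_irrefl (A : {set D}) :
  irreflexive (fun x y : {z : D | z \in A} => arc (val x) (val y)).
Proof. by move=> x; rewrite arc_irrefl. Qed.

Definition induced (A : {set D}) : digraph := Digraph (@induced_irrefl A).

Definition delete_vertices (I : {set D}) : digraph := induced (~: I).

End Digraph.

Definition acyclic_set (D : digraph) (A : {set D}) : Prop :=
  acyclic (induced A).

(* Main.v *)
Require Import Defs.
From mathcomp Require Import all_boot all_order all_algebra.
From mathcomp Require Import zify lra.
(* [arc] has to denote the arcs of a digraph, not the arcs of cyclic
   sequences. *)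
Import Defs Num.Theory GRing.Theory.
Set Implicit Arguments.
Unset Strict Implicit.
Unset Printing Implicit Defensive.

(** Write omega for the biclique number and Delta for the maximum degree, and
    assume 3 * omega > 2 * (Delta + 1).

    Maximum bicliques that meet are forced to overlap a lot: the closed
    out-neighbourhood of a common vertex contains their union.  Combined with
    Hajnal's inequality |cap| + |cup| >= 2 * omega ([card_common_cover_ge]),
    this shows that meeting is an equivalence relation on maximum bicliques and
    that all the members of one class share a vertex ([common_inhabited],
    [meet_trans]).  The common part of a class is its core.  The cores are
    disjoint and nonempty, and a set containing one vertex of each core meets
    every maximum biclique.

    Call an arc between different cores a cross arc.  With k = Delta + 1 - omega,
    a vertex of a core F has at most min(k, |F| - k) outgoing cross arcs
    ([cores_degree_condition]): its out-neighbourhood is mostly used up by the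
    union of its own class, and the larger this union is, the fewer arcs are
    left, while Hajnal's inequality relates its size to |F|.

    So it remains to find an acyclic transversal of disjoint classes F under
    this bound on out-degrees, with no bound on in-degrees
    ([acyclic_transversal]).  This is a directed form of the lopsided theorem
    on independent transversals, by a Haxell-type exchange.  Take an acyclic
    system of representatives of all the classes but one class A, and grow a
    set S of classes, initially {A}, and a set W of fewer than |S| vertices.
    The degree bound leaves in the union of S a vertex x that receives no arc
    from W or from the representatives of S ([undominated_vertex]).  The
    obstruction to using x is its feedback: the in-neighbours of x among the
    representatives that are reachable from W or x.  A system is chosen that
    minimises it.  If it is empty, x lies on no cycle, so it can become a
    representative.  Otherwise x joins W and the classes of the feedback join
    S.  If a later vertex y without feedback lies in one of those classes, it
    can replace the representative there; as y is not reachable from W, the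
    exchange adds nothing to earlier feedbacks and removes the old
    representative from that of x, against minimality.  As S cannot grow for
    ever, some vertex of A without feedback appears, and it completes the
    system.

    A vertex set that is acyclic contains at most one vertex of any biclique,
    so deleting the transversal lowers omega by exactly one. *)

(** * Reachability and feedback *)

Section Reach.
Variables (T : finType) (e : rel T).
Implicit Types (X M W : {set T}) (u v w x y z : T).

Definition arcs_in X : rel T := [rel u v | [&& u \in X, v \in X & e u v]].

(** An arc that can be walked back closes a directed cycle; this form is
    decidable without enumerating cycles. *)
Definition acyclic_in X : bool :=
  [forall u in X, forall v in X, ~~ (e u v && connect (arcs_in X) v u)].

Lemma connect_subset X X' u v :
  X \subset X' -> connect (arcs_in X) u v -> connect (arcs_in X') u v.
Proof.
move=> sXX'; apply: connect_sub => a b /and3P[aX bX eab].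
by apply: connect1; apply/and3P; split=> //; apply: (subsetP sXX').
Qed.

Lemma connect_last_arc X u v : connect (arcs_in X) u v -> u != v ->
  exists2 z, connect (arcs_in X) u z & arcs_in X z v.
Proof.
case/connectP=> p; case/lastP: p => [|p z] /= pth ->; first by rewrite eqxx.
rewrite last_rcons rcons_path in pth * => _.
by case/andP: pth => pth ez; exists (last u p) => //; apply/connectP; exists p.
Qed.

(** A walk in [y |: X] either avoids y or can be cut at y. *)
Lemma connect_add X y u v : connect (arcs_in (y |: X)) u v -> u \in X ->
  connect (arcs_in X) u v \/
  connect (arcs_in (y |: X)) u y /\ connect (arcs_in (y |: X)) y v.
Proof.
case/connectP=> p pth -> uX {v}.
elim/last_ind: p pth => [|p v IHp] /=; first by left.
rewrite rcons_path last_rcons => /andP[pth lv].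
have clv : connect (arcs_in (y |: X)) (last u p) v by apply: connect1.
case: (IHp pth) => [c|[c1 c2]]; last first.
  by right; split=> //; apply: (connect_trans c2 clv).
case/and3P: (lv) => lX vX elv.
have cl : connect (arcs_in (y |: X)) u (last u p) by apply/connectP; exists p.
case: (eqVneq v y) => [vy|nvy].
  by right; rewrite vy in clv *; split=> //; apply: (connect_trans cl clv).
case: (eqVneq (last u p) y) => [ly|nly].
  by right; rewrite ly in cl clv; split.
left; apply: (connect_trans c); apply: connect1.
apply/and3P; split=> //.
  by move: lX; rewrite in_setU1 (negPf nly).
by move: vX; rewrite in_setU1 (negPf nvy).
Qed.

(** The vertices through which a directed cycle, or a walk from W, would enter
    y if y were added to M.  Walks from W are counted so that a vertex without
    feedback is invisible from every vertex of W. *)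
Definition feedback M W y : {set T} :=
  [set z in M :|: (y |: W) |
    e z y && [exists w in y |: W, connect (arcs_in (M :|: (y |: W))) w z]].

Lemma feedbackP M W y z :
  reflect [/\ z \in M :|: (y |: W), e z y &
             exists2 w, w \in y |: W & connect (arcs_in (M :|: (y |: W))) w z]
          (z \in feedback M W y).
Proof.
apply: (iffP setIdP) => [[zX /andP[ez /exists_inP]] | [zX ez exw]].
  by case=> w wW cw; split=> //; exists w.
by split=> //; rewrite ez; apply/exists_inP.
Qed.

Definition free M W y := feedback M W y == set0.

Lemma free_subset M W W' y : W \subset W' -> free M W' y -> free M W y.
Proof.
move=> sW /eqP f0; rewrite /free -subset0 -f0; apply/subsetP=> z.
have sY := setUS [set y] sW; have sM := setUS M sY.
case/feedbackP=> zX ez [w wW cw]; apply/feedbackP; split=> //.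
  exact: (subsetP sM).
by exists w; [apply: (subsetP sY) | apply: connect_subset cw].
Qed.

Lemma free_no_arc M W y w z : free M W y -> w \in y |: W ->
  connect (arcs_in (M :|: (y |: W))) w z -> z \in M :|: (y |: W) -> ~~ e z y.
Proof.
move=> /eqP f0 wW cw zX; apply/negP=> ez.
have: z \in feedback M W y by apply/feedbackP; split=> //; exists w.
by rewrite f0 inE.
Qed.

Lemma free_unreachable M W y w : free M W y -> w \in y |: W ->
  connect (arcs_in (M :|: (y |: W))) w y -> w = y.
Proof.
move=> fy wW cw; apply/eqP/negPn/negP=> nwy.
case: (connect_last_arc cw nwy) => z cz /and3P[zX _ ezy].
by have := free_no_arc fy wW cz zX; rewrite ezy.
Qed.

(** A new cycle would pass through y, and the vertex before y on it would be
    reachable from y, hence belong to the feedback of y. *)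
Lemma acyclic_in_add M y : acyclic_in M -> free M set0 y ->
  acyclic_in (y |: M).
Proof.
move=> acM fy; have yy : y \in y |: set0 by rewrite !inE eqxx.
have eX : M :|: (y |: set0) = y |: M by rewrite setU0 setUC.
(* The case of a closed walk through y: it can be entered at y along its
   last arc, whose source is then in the feedback of y. *)
have key u v : u \in y |: M -> v \in y |: M -> e u v ->
    connect (arcs_in (y |: M)) v y -> connect (arcs_in (y |: M)) y u -> False.
  move=> uX vX euv cvy cyu.
  case: (eqVneq v y) => [vy|nvy].
    have := free_no_arc (z := u) fy yy.
    by rewrite eX -vy euv; rewrite vy => /(_ cyu uX).
  case: (connect_last_arc cvy nvy) => z cvz /and3P[zX _ ezy].
  have := free_no_arc (z := z) fy yy; rewrite eX ezy => /(_ _ zX) H.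
  suff: false by []. apply: H.
  apply: connect_trans cyu (connect_trans (connect1 _) cvz).
  by apply/and3P.
apply/forall_inP=> u uX; apply/forall_inP=> v vX; apply/negP=> /andP[euv cvu].
case: (eqVneq v y) => [vy|nvy].
  by apply: (key u v) => //; [rewrite vy connect0 | rewrite -{2}vy].
case: (eqVneq u y) => [uy|nuy].
  by apply: (key u v) => //; [rewrite -{2}uy | rewrite uy connect0].
have vM : v \in M by move: vX; rewrite !inE (negPf nvy).
have uM : u \in M by move: uX; rewrite !inE (negPf nuy).
case: (connect_add cvu vM) => [cM|[c1 c2]]; last exact: (key u v).
by move/forall_inP/(_ u uM)/forall_inP/(_ v vM): acM; rewrite euv cM.
Qed.

Lemma acyclic_in_subset X X' : X \subset X' -> acyclic_in X' -> acyclic_in X.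
Proof.
move=> sX acX; apply/forall_inP=> u uX; apply/forall_inP=> v vX.
apply/negP=> /andP[euv cvu].
move/forall_inP/(_ u (subsetP sX _ uX))/forall_inP: acX.
move/(_ v (subsetP sX _ vX)).
by rewrite euv (connect_subset sX cvu).
Qed.

(** A vertex y that is not reachable from x and W cannot lie on a walk that
    witnesses the feedback of x, so bringing y in creates no new feedback for x.
    The case where y itself belongs to W is harmless, since the walk was then
    available before. *)
Lemma feedback_exchange M M' W x y z :
  (forall w, w \in x |: W -> ~~ e w x) ->
  free M (x |: W) y -> M' \subset y |: M -> z \in feedback M' W x ->
  [/\ z \in feedback M W x, z \in M' & z != y].
Proof.
move=> undom fy sM' /feedbackP[zX ezx [w wW cw]].
have zM' : z \in M'.
  by move: zX; rewrite in_setU => /orP[// | zW]; move: (undom z zW); rewrite ezx.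
set X := M :|: (x |: W).
have sX : M' :|: (x |: W) \subset y |: X.
  rewrite subUset setUA; apply/andP; split.
    by apply: subset_trans sM' (subsetUl _ _).
  exact: subsetUr.
have eX : M :|: (y |: (x |: W)) = y |: X by rewrite setUCA.
have wX : w \in X by rewrite inE wW orbT.
have cX : connect (arcs_in X) w z.
  have cy := connect_subset sX cw.
  case: (connect_add cy wX) => // -[cwy cyz].
  have wy : w = y.
    by apply: (free_unreachable fy); rewrite ?eX // inE wW orbT.
  have <- : y |: X = X; last exact: cy.
  by apply/setUidPr; rewrite sub1set -wy.
have nzy : z != y.
  apply/negP=> /eqP zy; have /negP := undom w wW; apply.
  suff -> : w = z by [].
  rewrite zy; apply: (free_unreachable fy); first by rewrite inE wW orbT.
  by rewrite eX -zy; apply: connect_subset cX; apply: subsetUr.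
split=> //; apply/feedbackP; split=> //; last by exists w.
by move/(subsetP sM'): zM'; rewrite !inE (negPf nzy) /= => ->.
Qed.

End Reach.

(** * Acyclic transversals *)

Section Transversal.
Variables (T : finType) (e : rel T) (k : nat).
Hypothesis e_irr : irreflexive e.
Local Notation system := {ffun {set T} -> T}.
Implicit Types (F G A : {set T}) (Q S : {set {set T}}) (f g : system).

Definition out v : {set T} := [set w | e v w].
Definition represents Q f := [forall F in Q, f F \in F].

(** The bound |out v| <= min(k, |F| - k), written without subtraction. *)
Definition degree_condition Q := forall F v, F \in Q -> v \in F ->
  #|out v| <= k /\ #|out v| + k <= #|F|.

Definition exchange f F y : system := [ffun G => if G == F then y else f G].

(** Double counting: the representatives dominate at most |F| - k vertices for
    each class F of S other than A, and W adds at most k for each of them, as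
    |W| < |S|.  Together they miss at least |A| vertices of the union of S. *)
Lemma undominated_vertex Q S A (W : {set T}) f :
  trivIset Q -> set0 \notin Q -> degree_condition Q ->
  S \subset Q -> A \in S -> W \subset cover Q -> #|W| < #|S| ->
  represents (S :\ A) f ->
  exists2 x, x \in cover S &
    forall z, z \in W :|: f @: (S :\ A) -> ~~ e z x.
Proof.
move=> tQ n0 deg sSQ AS WQ ltWS rep.
have AQ := subsetP sSQ A AS.
case: (pickP [pred x | (x \in cover S) &&
    [forall z in W :|: f @: (S :\ A), ~~ e z x]]) => [x /andP[xS H]|nox].
  by exists x => // z zX; move/forall_inP: H; apply.
have sub : cover S \subset
    (\bigcup_(z in W) out z) :|: \bigcup_(F in S :\ A) out (f F).
  apply/subsetP=> x xS; move/negbT: (nox x); rewrite /= xS /=.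
  case/forall_inPn=> z zX; rewrite negbK => ezx.
  case/setUP: zX => [zW|/imsetP[F FS zF]]; apply/setUP; [left|right].
    by apply/bigcupP; exists z; rewrite ?inE.
  by apply/bigcupP; exists F => //; rewrite inE -zF.
have bcup (I : finType) (P : {set I}) (h : I -> {set T}) :
    #|\bigcup_(i in P) h i| <= \sum_(i in P) #|h i|.
  apply: (big_ind2 (fun (X : {set T}) n => #|X| <= n)) => //.
    by rewrite cards0.
  move=> X n X' n' lX lX'; rewrite (leq_trans (leq_card_setU _ _).1) //.
  exact: leq_add.
have cA : 0 < #|A|.
  by rewrite card_gt0; apply: contraNneq n0 => <-.
have sumW : \sum_(z in W) #|out z| <= #|W| * k.
  rewrite -sum_nat_const; apply: leq_sum => z zW.
  by case/bigcupP: (subsetP WQ z zW) => F FQ zF; case: (deg F z FQ zF).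
have sumM : \sum_(F in S :\ A) #|out (f F)| + #|S :\ A| * k
    <= \sum_(F in S :\ A) #|F|.
  rewrite -sum_nat_const -big_split /=; apply: leq_sum => F FS.
  have FQ : F \in Q by case/setD1P: FS => _ /(subsetP sSQ).
  by move/forall_inP/(_ F FS): rep => /(deg F _ FQ)[].
have cS : #|cover S| = #|A| + \sum_(F in S :\ A) #|F|.
  have /eqP <- : trivIset S by apply: trivIsetS tQ.
  by rewrite (big_setD1 A AS).
have := subset_leq_card sub; rewrite cS.
move=> /leq_trans/(_ (leq_card_setU _ _).1).
move=> /leq_trans/(_ (leq_add (bcup _ _ _) (bcup _ _ _))).
have le : #|W| * k <= #|S :\ A| * k.
  by rewrite leq_mul2r; move: ltWS; rewrite (cardsD1 A S) AS ltnS => ->; rewrite orbT.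
lia.
Qed.

Definition members Q A f : {set T} := f @: (Q :\ A).

Lemma members_exchange Q A f F y :
  members Q A (exchange f F y) \subset y |: members Q A f.
Proof.
apply/subsetP=> z /imsetP[G GQ ->]; rewrite ffunE.
by case: eqP => _; rewrite !inE ?eqxx // imset_f ?orbT.
Qed.

(** By disjointness of the classes, the replaced representative is no longer a
    member after the exchange, unless it was put back. *)
Lemma exchange_outgoing Q A f F y : trivIset Q -> represents (Q :\ A) f ->
  F \in Q :\ A -> f F \in members Q A (exchange f F y) -> f F = y.
Proof.
move=> tQ rep FQ /imsetP[G GQ]; rewrite ffunE; case: eqP => // nGF eqf.
case/setD1P: (FQ) => _ FQ'; case/setD1P: (GQ) => _ GQ'; case: nGF.
apply/eqP/negPn/negP=> nGF; move/trivIsetP: tQ => /(_ G F GQ' FQ' nGF).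
rewrite disjoints_subset => /subsetP/(_ (f F)).
rewrite inE {1}eqf (forall_inP rep G GQ) (forall_inP rep F FQ) => H.
by have := H isT.
Qed.

(** The invariant of the search.  [Fam] is a family of systems of
    representatives of all the classes but A, which agree on S.  No vertex of
    the classes in S can be brought into such a system without feedback, whereas
    outside S every exchange without feedback stays in the family.  The proof
    enlarges S and W, and restricts [Fam] to the systems with the smallest
    feedback for the new vertex of W; minimality preserves both closure
    properties. *)
Lemma no_closed_family Q A S (W : {set T}) (Fam : {set system}) f0 :
  trivIset Q -> set0 \notin Q -> degree_condition Q -> A \in Q ->
  S \subset Q -> A \in S -> W \subset cover Q -> #|W| < #|S| ->
  f0 \in Fam ->
  (forall f, f \in Fam -> represents (Q :\ A) f) ->
  (forall f, f \in Fam -> {in S :\ A, f =1 f0}) ->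
  (forall f y, f \in Fam -> y \in cover S ->
     ~~ free e (members Q A f) W y) ->
  (forall f F y, f \in Fam -> F \in Q :\: S -> y \in F ->
     free e (members Q A f) W y -> exchange f F y \in Fam) ->
  False.
Proof.
move=> tQ n0 deg AQ.
have [n] := ubnP #|Q :\: S|; elim: n => // n IHn in S W Fam f0 *.
move=> ltn sSQ AS sWQ ltWS f0Fam rep agree notfree closed.
have rep0 : represents (S :\ A) f0.
  apply/forall_inP=> F FS; apply: (forall_inP (rep f0 f0Fam)).
  exact: (subsetP (setSD _ sSQ)).
have [x xS undom] := undominated_vertex tQ n0 deg sSQ AS sWQ ltWS rep0.
have undomW w : w \in x |: W -> ~~ e w x.
  case/setU1P=> [->|wW]; first by rewrite e_irr.
  by apply: undom; rewrite inE wW.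
pose fb f := feedback e (members Q A f) W x.
have fbP f z : f \in Fam -> z \in fb f ->
    exists2 F, F \in (Q :\: S) & z = f F.
  move=> fFam /feedbackP[zX ezx _].
  case/setUP: zX => [|/undomW]; last by rewrite ezx.
  case/imsetP=> F /setD1P[nFA FQ] zF; exists F => //.
  rewrite inE FQ andbT; apply/negP=> FS.
  have FSA : F \in S :\ A by rewrite !inE nFA.
  have := undom z; rewrite ezx inE zF (agree f fFam F FSA) imset_f ?orbT //.
  by move/(_ isT).
case: (arg_minnP (fun f => #|fb f|) f0Fam) => f1 f1Fam minf.
set B := fb f1 in minf *.
have Bn0 : B != set0 by have := notfree f1 x f1Fam xS.
have swap f y G : f \in Fam -> G \in Q :\: S -> y \in G ->
    free e (members Q A f) (x |: W) y ->
    exchange f G y \in Fam /\ fb (exchange f G y) \subset fb f :\ f G.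
  move=> fFam GQ yG fy; split.
    by apply: closed => //; apply: free_subset fy; apply: subsetUr.
  apply/subsetP=> z zfb.
  have [z1 z2 z3] := feedback_exchange undomW fy (members_exchange Q A f G y) zfb.
  rewrite in_setD1 [z \in fb f]z1 andbT; apply: contraNneq z3 => zfG; rewrite zfG.
  apply/eqP; apply: (exchange_outgoing tQ (rep f fFam)); last by rewrite -zfG.
  case/setDP: GQ => GQ nGS; rewrite !inE GQ andbT.
  by apply: contraNneq nGS => ->.
(* Since the feedback of x in f is B, the vertex f1 F of B is a
   representative in f; by disjointness it is that of F. *)
have agree_new f F : f \in Fam -> fb f = B -> F \in Q :\: S -> f1 F \in B ->
    f F = f1 F.
  move=> fFam fbf FQ.
  rewrite -fbf => /(fbP f _ fFam)[G GQ eqFG]; rewrite eqFG.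
  congr (f _); apply/eqP/negPn/negP=> nFG.
  case/setDP: FQ => FQ nFS; case/setDP: GQ => GQ nGS.
  have FQA : F \in Q :\ A by rewrite !inE FQ andbT; apply: contraNneq nFS => ->.
  have GQA : G \in Q :\ A by rewrite !inE GQ andbT; apply: contraNneq nGS => ->.
  move/trivIsetP: tQ => /(_ F G FQ GQ nFG).
  rewrite disjoints_subset => /subsetP/(_ (f1 F)).
  rewrite (forall_inP (rep f1 f1Fam) F FQA) inE eqFG.
  by rewrite (forall_inP (rep f fFam) G GQA) => H; have := H isT.
pose S' := S :|: [set F in Q :\: S | f1 F \in B].
pose Fam' := [set f in Fam | fb f == B].
have sSS' : S \subset S' := subsetUl _ _.
have newS : exists F, F \in S' :\: S.
  case/set0Pn: Bn0 => z zB; have [F FQ zF] := fbP f1 z f1Fam zB.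
  exists F; case/setDP: (FQ) => FQ' nFS; rewrite in_setD nFS in_setU.
  by apply/orP; right; apply/setIdP; rewrite -zF.
have ltSS' : #|S| < #|S'|.
  apply: proper_card; rewrite properE sSS' /=; case: newS => F.
  by case/setDP=> FS' nFS; apply/subsetPn; exists F.
apply: (IHn S' (x |: W) Fam' f1).
- rewrite -ltnS; apply: leq_trans ltn; rewrite ltnS; apply: proper_card.
  rewrite properE setDS //=; case: newS => F /setDP[FS' nFS].
  apply/subsetPn; exists F; rewrite inE ?FS' // nFS.
  by move: FS'; rewrite !inE (negPf nFS) /=; case/andP.
- rewrite subUset sSQ; apply/subsetP=> F; rewrite !inE.
  by case/andP=> /andP[].
- by rewrite (subsetP sSS').
- rewrite subUset sub1set sWQ andbT.
  by case/bigcupP: xS => F FS xF; apply/bigcupP; exists F; rewrite ?(subsetP sSQ).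
- apply: leq_ltn_trans ltSS'; rewrite cardsU1; apply: leq_trans ltWS.
  by rewrite -[#|W|.+1]add1n leq_add2r; case: (x \notin W).
- by apply/setIdP; split.
- by move=> f /setIdP[fFam _]; apply: rep.
- move=> f /setIdP[fFam /eqP fbf] F /setD1P[nFA].
  case/setUP=> [FS|/setIdP[FQ fFB]]; last exact: agree_new.
  by rewrite !agree // !inE nFA.
- move=> f y /setIdP[fFam /eqP fbf] /bigcupP[G].
  case/setUP=> [GS|/setIdP[GQ fGB]] yG.
    have yS : y \in cover S by apply/bigcupP; exists G.
    by apply: contra (notfree f y fFam yS); apply: free_subset; apply: subsetUr.
  apply/negP=> fy; have [f'Fam sfb] := swap f y G fFam GQ yG fy.
  have := minf _ f'Fam; rewrite leqNgt => /negP; apply.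
  (* The exchange removes f G, which is in the feedback B of x. *)
  apply: leq_ltn_trans (subset_leq_card sfb) _; rewrite fbf.
  by rewrite (cardsD1 (f G) B) (agree_new f G) // fGB.
- move=> f G y /setIdP[fFam /eqP fbf] /setDP[GQ nGS'] yG fy.
  have GQS : G \in Q :\: S.
    by rewrite inE GQ andbT; apply: contra nGS'; apply: (subsetP sSS').
  have [f'Fam sfb] := swap f y G fFam GQS yG fy.
  rewrite inE f'Fam eqEcard minf // andbT -fbf.
  by apply: subset_trans sfb (subsetDl _ _).
Qed.

Lemma representatives_transversal Q f : trivIset Q -> set0 \notin Q ->
  represents Q f -> is_transversal (f @: Q) Q (cover Q).
Proof.
move=> tQ n0 rep; apply/and3P; split; first by rewrite /partition eqxx tQ.
  apply/subsetP=> _ /imsetP[F FQ ->]; apply/bigcupP; exists F => //.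
  exact: (forall_inP rep).
apply/forall_inP=> F FQ; apply/cards1P; exists (f F); apply/setP=> z.
rewrite !inE; apply/andP/eqP => [[/imsetP[G GQ ->] fGF]|->]; last first.
  by rewrite imset_f // (forall_inP rep).
by congr (f _); rewrite -(def_pblock tQ FQ fGF) (def_pblock tQ GQ) // (forall_inP rep).
Qed.

(** Induction on the number of classes: if no vertex of A extends a system for
    the other classes, then all acyclic systems for these form a family that is
    closed in the sense of [no_closed_family], with S = {A} and W empty. *)
Theorem acyclic_transversal Q :
  trivIset Q -> set0 \notin Q -> degree_condition Q ->
  exists2 X, is_transversal X Q (cover Q) & acyclic_in e X.
Proof.
move=> tQ n0 deg.
(* A system assigns a vertex to every set, which needs a vertex to start
   with. *)
case: (pickP (mem (cover Q))) => [x0 _|noT]; last first.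
  have Q0 : Q = set0.
    apply/setP=> F; rewrite inE; apply: contraNF n0 => FQ.
    suff <- : F = set0 by [].
    apply/setP=> z; rewrite inE; apply/negP=> zF.
    by have /negP := negbT (noT z); apply; apply/bigcupP; exists F.
  exists set0; last by apply/forall_inP=> u; rewrite inE.
  rewrite /is_transversal /partition eqxx tQ n0 sub0set /=.
  by apply/forall_inP=> F; rewrite Q0 inE.
suff [f [rep ac]] : exists f : system, represents Q f /\ acyclic_in e (f @: Q).
  by exists (f @: Q); first exact: representatives_transversal.
have [n] := ubnP #|Q|; elim: n => // n IHn in Q tQ n0 deg *; move=> ltn.
case: (set_0Vmem Q) => [Q0|[A AQ]].
  exists [ffun => x0]; rewrite /represents Q0 imset0.
  by split; apply/forall_inP=> F; rewrite inE.
have sQ : Q :\ A \subset Q by apply: subsetDl.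
have [||||f [rep ac]] := IHn (Q :\ A).
- exact: trivIsetS tQ.
- by apply: contra n0; apply: (subsetP sQ).
- by move=> F v FQ; apply: deg; apply: (subsetP sQ).
- by move: ltn; rewrite (cardsD1 A Q) AQ.
pose Fam := [set f | represents (Q :\ A) f & acyclic_in e (members Q A f)].
case: (boolP [exists g in Fam, [exists y in A, free e (members Q A g) set0 y]]).
  case/exists_inP=> g /setIdP[repg acg] /exists_inP[y yA fy].
  exists (exchange g A y); split.
    apply/forall_inP=> F FQ; rewrite ffunE; case: eqP => [->|/eqP nFA] //.
    by apply: (forall_inP repg); rewrite !inE nFA.
  apply: acyclic_in_subset (acyclic_in_add acg fy).
  apply/subsetP=> z /imsetP[F FQ ->]; rewrite ffunE.
  by case: eqP => [_|/eqP nFA]; rewrite !inE ?eqxx // imset_f ?orbT // !inE nFA.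
move/exists_inPn=> none; case: (@no_closed_family Q A [set A] set0 Fam f) => //.
- by rewrite sub1set.
- by rewrite inE.
- exact: sub0set.
- by rewrite cards0 cards1.
- by rewrite inE rep ac.
- by move=> g /setIdP[].
- by move=> g _ F; rewrite !inE => /andP[/negPf->].
- move=> g y gFam; rewrite /cover big_set1 => yA.
  by move: (none g gFam); rewrite negb_exists_in => /forall_inP/(_ y yA).
move=> g F y /setIdP[repg acg] /setDP[FQ]; rewrite inE => nFA yF fy.
rewrite inE; apply/andP; split; last first.
  exact: acyclic_in_subset (members_exchange _ _ _ _ _) (acyclic_in_add acg fy).
apply/forall_inP=> G GQ; rewrite ffunE; case: eqP => [->|_] //.
exact: (forall_inP repg).
Qed.
End Transversal.

(** * Maximum bicliques and their cores *)

Lemma bicliqueP (D : digraph) (B : {set D}) :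
  reflect {in B &, forall u v, u != v -> arc u v && arc v u} (biclique B).
Proof.
apply: (iffP forall_inP) => [bB u v uB vB nuv | bB u uB].
  by move/forall_inP/(_ v vB)/implyP: (bB u uB); apply.
by apply/forall_inP=> v vB; apply/implyP; apply: bB.
Qed.

Lemma card_biclique (D : digraph) (B : {set D}) :
  biclique B -> #|B| <= biclique_number D.
Proof. by move=> bB; apply: (@leq_bigmax_cond _ (@biclique D) (fun B => #|B|)). Qed.

Section Cores.
Variable D : digraph.
Implicit Types (B K L : {set D}) (C : {set {set D}}) (u v : D).
Local Notation omega := (biclique_number D).

Definition max_bicliques : {set {set D}} :=
  [set B | biclique B & #|B| == omega].

Lemma exists_max_biclique : exists B, B \in max_bicliques.
Proof.
have b0 : biclique (set0 : {set D}) by apply/bicliqueP=> u; rewrite inE.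
have [|B bB eqB] := @eq_bigmax_cond _ (@biclique D) (fun B => #|B|).
  by apply/card_gt0P; exists set0.
exists B; apply/setIdP; split; first exact: bB.
by rewrite /biclique_number -eqB.
Qed.

Definition common C : {set D} := \bigcap_(K in C) K.

Lemma cover_subset_neighborhood C v : C \subset max_bicliques ->
  v \in common C -> cover C \subset v |: [set w | arc v w].
Proof.
move=> sC /bigcapP vC; apply/subsetP=> u /bigcupP[K KC uK]; rewrite !inE.
case: (eqVneq u v) => //= nuv.
have /setIdP[/bicliqueP bK _] := subsetP sC K KC.
by have /andP[] := bK u v uK (vC K KC) nuv.
Qed.

Lemma card_closed_neighborhood v :
  #|v |: [set w | arc v w]| <= (Delta_max D).+1.
Proof.
rewrite cardsU1 -add1n leq_add ?leq_b1 //.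
apply: leq_trans (leq_bigmax v); exact: leq_maxl.
Qed.

Lemma card_cover_le C v : C \subset max_bicliques ->
  v \in common C -> #|cover C| <= (Delta_max D).+1.
Proof.
move=> sC vC; apply: leq_trans (card_closed_neighborhood v).
exact/subset_leq_card/cover_subset_neighborhood.
Qed.

(** A vertex in all members of C is linked to every vertex of their union, so
    the common part of C together with K :&: cover C is a biclique; its size is
    at most omega. *)
Lemma card_common_setI C K : C \subset max_bicliques -> C != set0 ->
  K \in max_bicliques ->
  #|common C| + #|K :&: cover C| <= omega + #|common C :&: K|.
Proof.
move=> sC /set0Pn[L LC] /setIdP[/bicliqueP bK _].
have bC M u v : M \in C -> u \in M -> v \in M -> u != v -> arc u v && arc v u.
  by move=> /(subsetP sC)/setIdP[/bicliqueP bM _]; apply: bM.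
have bU : biclique (common C :|: (K :&: cover C)).
  apply/bicliqueP=> u v; case/setUP=> [/bigcapP uX|/setIP[uK uU]].
    case/setUP=> [/bigcapP vX|/setIP[vK /bigcupP[M MC vM]]].
      exact: (bC L u v LC (uX L LC) (vX L LC)).
    exact: (bC M u v MC (uX M MC)).
  case/setUP=> [/bigcapP vX|/setIP[vK vU]]; last exact: bK.
  case/bigcupP: uU => M MC uM; exact: (bC M u v MC uM (vX M MC)).
have := card_biclique bU; rewrite cardsU.
have -> : common C :&: (K :&: cover C) = common C :&: K.
  rewrite setIA; apply/setIidPl; apply: subset_trans (subsetIl _ _) _.
  by apply/subsetP=> u /bigcapP uX; apply/bigcupP; exists L; rewrite ?uX.
by lia.
Qed.

Lemma common_setD1 C L : L \in C -> common C = common (C :\ L) :&: L.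
Proof. by move=> LC; rewrite /common (big_setD1 L LC) setIC. Qed.

Lemma cover_setD1 C L : L \in C -> cover C = cover (C :\ L) :|: L.
Proof. by move=> LC; rewrite /cover (big_setD1 L LC) setUC. Qed.

(** Hajnal's inequality.  Adding a member L to C shrinks the common part by no
    more than it enlarges the union, by [card_common_setI]. *)
Lemma card_common_cover_ge C : C \subset max_bicliques -> C != set0 ->
  omega + omega <= #|common C| + #|cover C|.
Proof.
have [n] := ubnP #|C|; elim: n => // n IHn in C *; move=> ltn sC.
case/set0Pn=> L LC; have /setIdP[_ /eqP cL] := subsetP sC L LC.
have sC' : C :\ L \subset max_bicliques := subset_trans (subsetDl _ _) sC.
rewrite (common_setD1 LC) (cover_setD1 LC).
case: (eqVneq (C :\ L) set0) => [->|n0].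
  by rewrite /common /cover !big_set0 setTI set0U cL.
have ltn' : #|C :\ L| < n by move: ltn; rewrite (cardsD1 L C) LC.
have IH := IHn _ ltn' sC' n0.
have := card_common_setI sC' n0 (subsetP sC L LC).
rewrite cardsU cL [cover _ :&: L]setIC.
have := subset_leq_card (subsetIl L (cover (C :\ L))); rewrite cL; move: IH.
move: (#|common (C :\ L)|) (#|cover _|) (#|L :&: _|) (#|_ :&: L|) omega => *.
lia.
Qed.

Section LargeBiclique.
Hypothesis large : 2 * (Delta_max D).+1 < 3 * omega.

Lemma max_biclique_inhabited K : K \in max_bicliques -> K != set0.
Proof. by case/setIdP=> _ /eqP cK; rewrite -card_gt0 cK; lia. Qed.

(** Kostochka's argument.  While the common part X is nonempty, the union has
    at most Delta + 1 vertices, so |X| >= 2 * omega - (Delta + 1).  A further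
    member L meets K in at least 2 * omega - (Delta + 1) vertices, all in the
    union; then [card_common_setI] gives
    |X :&: L| >= 3 * omega - 2 * (Delta + 1) > 0. *)
Lemma common_inhabited C K : C \subset max_bicliques -> K \in C ->
  (forall L, L \in C -> L :&: K != set0) -> common C != set0.
Proof.
have [n] := ubnP #|C|; elim: n => // n IHn in C *; move=> ltn sC KC meet.
have KM := subsetP sC K KC.
case: (set_0Vmem (C :\ K)) => [C1|[L LCK]].
  rewrite (common_setD1 KC) C1 /common big_set0 setTI.
  exact: max_biclique_inhabited.
case/setD1P: LCK => nLK LC; have LM := subsetP sC L LC.
have sC' : C :\ L \subset max_bicliques := subset_trans (subsetDl _ _) sC.
have KC' : K \in C :\ L by rewrite !inE eq_sym nLK.
have n0 : C :\ L != set0 by apply/set0Pn; exists K.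
have /set0Pn[v vX] : common (C :\ L) != set0.
  apply: IHn => //; first by move: ltn; rewrite (cardsD1 L C) LC.
  by move=> M /setD1P[_]; apply: meet.
have hU := card_cover_le sC' vX; have hX := card_common_cover_ge sC' n0.
have hXL := card_common_setI sC' n0 LM.
have [/setIdP[_ /eqP cK] /setIdP[_ /eqP cL]] := (KM, LM).
have LK : omega + omega <= #|L :&: K| + (Delta_max D).+1.
  case/set0Pn: (meet L LC) => u /setIP[uL uK].
  have: #|cover [set L; K]| <= (Delta_max D).+1.
    apply: (@card_cover_le _ u); first by rewrite subUset !sub1set LM.
    by apply/bigcapP=> M /set2P[]->.
  have := cardsUI L K; rewrite /cover big_setU1 ?inE // big_set1 cL cK => <-.
  by rewrite addnC leq_add2l.
have sLK : #|L :&: K| <= #|L :&: cover (C :\ L)|.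
  by apply/subset_leq_card/setIS/bigcup_sup.
rewrite (common_setD1 LC) -card_gt0.
move: hU hX hXL LK sLK large.
move: (#|common (C :\ L)|) (#|cover _|) (#|L :&: K|) (#|L :&: cover _|).
move: (#|_ :&: L|) omega (Delta_max D) => *; lia.
Qed.

(** The three bicliques all meet L, so they share a vertex. *)
Lemma meet_trans K L M : K \in max_bicliques -> L \in max_bicliques ->
  M \in max_bicliques -> K :&: L != set0 -> L :&: M != set0 ->
  K :&: M != set0.
Proof.
move=> Km Lm Mm KL LM.
have /set0Pn[v /bigcapP vC] : common [set K; L; M] != set0.
  apply: (@common_inhabited _ L).
  - by rewrite !subUset !sub1set Km Lm.
  - by rewrite !inE eqxx orbT.
  move=> N; rewrite !inE -orbA => /or3P[]/eqP-> //; last by rewrite setIC.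
  by rewrite setIid max_biclique_inhabited.
by apply/set0Pn; exists v; rewrite inE !vC // !inE eqxx ?orbT.
Qed.

Definition meeting K := [set L in max_bicliques | L :&: K != set0].
Definition core K := common (meeting K).
Definition cores := core @: max_bicliques.

Lemma meeting_self K : K \in max_bicliques -> K \in meeting K.
Proof. by move=> Km; rewrite inE Km setIid max_biclique_inhabited. Qed.

Lemma meeting_subset K : meeting K \subset max_bicliques.
Proof. by apply/subsetP=> L /setIdP[]. Qed.

Lemma core_subset K : K \in max_bicliques -> core K \subset K.
Proof. by move=> Km; apply/subsetP=> v /bigcapP; apply; apply: meeting_self. Qed.

Lemma core_eq K L : K \in max_bicliques -> L \in max_bicliques ->
  K :&: L != set0 -> core K = core L.
Proof.
move=> Km Lm KL; congr common; apply/setP=> M; rewrite !inE.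
case Mm: (biclique M && _) => //=; have {}Mm : M \in max_bicliques by rewrite inE.
by apply/idP/idP=> H; apply: meet_trans H _ => //; rewrite setIC.
Qed.

Lemma trivIset_cores : trivIset cores.
Proof.
apply/trivIsetP=> _ _ /imsetP[K Km ->] /imsetP[L Lm ->]; apply: contraNT.
rewrite -setI_eq0 => /set0Pn[v /setIP[vK vL]]; apply/eqP/core_eq => //.
apply/set0Pn; exists v; apply/setIP; split.
  exact: (subsetP (core_subset Km)).
exact: (subsetP (core_subset Lm)).
Qed.

Lemma cores_inhabited : set0 \notin cores.
Proof.
apply/imsetP=> -[K Km /esym/eqP]; apply/negP.
apply: (common_inhabited (meeting_subset K) (meeting_self Km)).
by move=> L /setIdP[].
Qed.

(** Meeting bicliques have the same core, so a vertex of the union of a class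
    can belong to no other core: cross arcs from the core of the class never end
    in that union. *)
Lemma cover_meeting_cores K v : K \in max_bicliques ->
  v \in cover (meeting K) -> v \in cover cores -> v \in core K.
Proof.
move=> Km /bigcupP[L /setIdP[Lm LK] vL] /bigcupP[_ /imsetP[M Mm ->] vM].
rewrite (core_eq Km Lm) ?(setIC K) // (core_eq Lm Mm) //.
by apply/set0Pn; exists v; rewrite inE vL (subsetP (core_subset Mm)).
Qed.

(** Only the arcs between different cores count: the other out-neighbours of a
    vertex of a core may be too many. *)
Definition cross_arc : rel D := [rel u v |
  [&& arc u v, v \in cover cores & pblock cores u != pblock cores v]].

Lemma cross_arc_irrefl : irreflexive cross_arc.
Proof. by move=> v; apply/negP=> /and3P[]; rewrite arc_irrefl. Qed.

(** Let U be the union of the class of K, and v a vertex of the core.  Then U is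
    contained in the closed out-neighbourhood of v, and no cross arc from v ends
    in U, so v has at most Delta + 1 - |U| outgoing cross arcs.  This is at most
    k as |U| >= omega.  As the core has at least 2 * omega - |U| vertices and
    3 * omega > 2 * (Delta + 1), adding k keeps the sum below the size of the
    core. *)
Lemma cores_degree_condition :
  degree_condition cross_arc ((Delta_max D).+1 - omega) cores.
Proof.
move=> _ v /imsetP[K Km ->] vK.
have sM := meeting_subset K; have vU := cover_subset_neighborhood sM vK.
have KU : omega <= #|cover (meeting K)|.
  have /setIdP[_ /eqP <-] := Km.
  by apply/subset_leq_card/bigcup_sup/meeting_self.
have out_le : #|out cross_arc v| + #|cover (meeting K)| <= (Delta_max D).+1.
  apply: leq_trans (card_closed_neighborhood v).
  rewrite -(cardsID (cover (meeting K)) (v |: _)) addnC (setIidPr vU) leq_add2l.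
  apply/subset_leq_card/subsetP=> u; rewrite inE => /and3P[vu uC npb].
  rewrite in_setD !inE vu orbT andbT; apply: contra npb => uU.
  have coreQ : core K \in cores by apply: imset_f.
  rewrite !(def_pblock trivIset_cores coreQ) //.
  exact: cover_meeting_cores.
have := card_common_cover_ge sM; rewrite -/(core K) => H.
have {H} : omega + omega <= #|core K| + #|cover (meeting K)|.
  by apply: H; apply/set0Pn; exists K; apply: meeting_self.
lia.
Qed.

(** * Transversals of the cores *)

Section CoreTransversal.
Variable I : {set D}.
Hypothesis transI : is_transversal I cores (cover cores).
Hypothesis acI : acyclic_in cross_arc I.

(** A transversal has one vertex in each core, so its arcs are cross arcs. *)
Lemma transversal_arc u v : u \in I -> v \in I -> arc u v ->
  arcs_in cross_arc I u v.
Proof.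
move=> uI vI uv; apply/and3P; split=> //; apply/and3P; split=> //.
  exact: (subsetP (transversal_sub transI)).
apply: contraTneq uv => /(pblock_inj transI uI vI) ->.
by rewrite arc_irrefl.
Qed.

Lemma transversal_no_return u v : u \in I -> v \in I -> arc u v ->
  ~~ connect (arcs_in cross_arc I) v u.
Proof.
move=> uI vI uv; have /and3P[_ _ euv] := transversal_arc uI vI uv.
by move/forall_inP/(_ u uI)/forall_inP/(_ v vI): acI; rewrite euv.
Qed.

Lemma transversal_acyclic : acyclic_set I.
Proof.
case=> [//|x [|y p]] /andP[]; first by rewrite /= arc_irrefl.
rewrite /= => /andP[xy pth] _.
have := transversal_no_return (valP x) (valP y) xy; case/negP.
apply/connectP; exists (map val (rcons p x)); last by rewrite last_map last_rcons.
apply: homo_path pth => a b; apply: transversal_arc; exact: valP.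
Qed.

Lemma transversal_meets_once K : K \in max_bicliques ->
  I :&: K != set0 /\ #|I :&: K| <= 1.
Proof.
move=> Km; split.
  have cQ : core K \in cores by apply: imset_f.
  have /and3P[_ _ /forall_inP/(_ _ cQ)/cards1P[v eqv]] := transI.
  have : v \in I :&: core K by rewrite eqv inE.
  case/setIP=> vI vK; apply/set0Pn; exists v.
  by rewrite inE vI (subsetP (core_subset Km)).
apply/card_le1_eqP=> u v /setIP[uI uK] /setIP[vI vK].
apply/eqP/negPn/negP=> nuv; have /setIdP[/bicliqueP bK _] := Km.
have /andP[vu uv] := bK v u vK uK nuv.
by have /negP := transversal_no_return uI vI uv; apply; apply/connect1/transversal_arc.
Qed.

(** A biclique of size omega that avoids I would be a maximum biclique not met
    by I, and a maximum biclique loses only one vertex. *)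
Lemma transversal_lowers_biclique_number :
  biclique_number (delete_vertices I) = omega - 1.
Proof.
have vinj : injective (val : delete_vertices I -> D) by apply: val_inj.
have om0 : 0 < omega by lia.
apply/eqP; rewrite eqn_leq; apply/andP; split.
  apply/bigmax_leqP=> B bB.
  have bB' : biclique (val @: B : {set D}).
    apply/bicliqueP=> _ _ /imsetP[u uB ->] /imsetP[v vB ->] nuv.
    have /bicliqueP bBP := bB; apply: (bBP u v uB vB).
    by apply: contraNneq nuv => ->.
  have := card_biclique bB'; rewrite leq_eqVlt => /orP[eqB|].
    have /transversal_meets_once[/set0Pn[v]] : val @: B \in max_bicliques.
      by rewrite inE bB'.
    case/setIP=> vI /imsetP[u _ vu]; have := valP u.
    by rewrite -vu inE vI.
  rewrite (card_imset _ vinj); lia.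
have [K Km] := exists_max_biclique; have /setIdP[bK /eqP cK] := Km.
have [_ le1] := transversal_meets_once Km.
pose B : {set delete_vertices I} := [set u | val u \in K].
have bB : biclique B.
  apply/bicliqueP=> u v; rewrite !inE => uK vK nuv.
  by have /bicliqueP bKP := bK; apply: (bKP _ _ uK vK); rewrite (inj_eq vinj).
apply: leq_trans (card_biclique bB).
have <- : #|val @: B| = #|B| by apply: card_imset.
have -> : val @: B = K :\: I.
  apply/setP=> v; rewrite inE; apply/imsetP/andP => [[u uB ->]|[nI vK]].
    by move: uB (valP u); rewrite !inE => -> ->.
  have vI' : v \in ~: I by rewrite inE.
  by exists (Sub v vI' : {z : D | z \in ~: I}); rewrite ?inE.
by rewrite cardsD cK setIC; lia.
Qed.

End CoreTransversal.
End LargeBiclique.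
End Cores.

(** * Deleting a transversal of the cores *)

Theorem theorem1p9 (D : digraph)
    (hD : (2%:R / 3%:R * ((Delta_max D)%:R + 1) < (biclique_number D)%:R :> rat)%R) :
  exists I : {set D},
    acyclic_set I /\
    biclique_number (delete_vertices I) = biclique_number D - 1.
Proof.
have large : 2 * (Delta_max D).+1 < 3 * biclique_number D.
  by move: hD; rewrite -(ltr_nat rat) !natrM -[(Delta_max D).+1]addn1 natrD; lra.
have [I transI acI] := acyclic_transversal (@cross_arc_irrefl D)
  (trivIset_cores large) (cores_inhabited large) (cores_degree_condition large).
exists I; split; first exact: transversal_acyclic transI acI.
exact: transversal_lowers_biclique_number transI acI.
Qed.
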